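(* Let $s\geq 2$, $m\geq 0$, $k\geq 1$ and $0\leq i\leq\inf(2s+m,k)$. Then \begin{align*} \Gamma_{i}^{\left[\substack{s\\ s+m}\right]\times k} &= 2\cdot\Gamma_{i-1}^{\left[\substack{s-1\\ s-1+(m+1)}\right]\times k} + 4\cdot\Gamma_{i-1}^{\left[\substack{s\\ s+(m-1)}\right]\times k} - 8\cdot\Gamma_{i-2}^{\left[\substack{s-1\\ s-1+m}\right]\times k} + \Delta_{i}^{\left[\substack{s\\ s+m}\right]\times k}, \end{align*} where the remainder is $$\Delta_{i}^{\left[\substack{s\\ s+m}\right]\times k} = \sigma_{i,i,i} - 3\cdot\sigma_{i-1,i-1,i-1} + 2\cdot\sigma_{i-2,i-2,i-2},$$ and $\sigma_{i,i,i}$ is the cardinality of the set $$\left\{(t,\eta)\in\mathbb{P}/\mathbb{P}_{k+s-1}\times\mathbb{P}/\mathbb{P}_{k+s+m-1} \;\middle|\; r\!\left(D^{\left[\substack{s-1\\ s-1+m}\right]\times k}(t,\eta)\right) = r\!\left(D^{\left[\substack{s\\ s+m-1}\right]\times k}(t,\eta)\right) = r\!\left(D^{\left[\substack{s\\ s+m}\right]\times k}(t,\eta)\right) = i\right\}.$$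
   Context: $\mathbb{K}=\mathbb{F}_2((T^{-1}))$, $\mathbb{P}$ its unit interval (series $\sum_{i\geq1}\alpha_iT^{-i}$), $\mathbb{P}_{n}$ the subgroup of series with $\alpha_1=\dots=\alpha_n=0$. For $t=\sum\alpha_iT^{-i}$, $\eta=\sum\beta_iT^{-i}$, $D^{\left[\substack{a\\ b}\right]\times k}(t,\eta)$ is the $(a+b)\times k$ matrix over $\mathbb{F}_2$ whose first $a$ rows form the persymmetric matrix $(\alpha_{i+j-1})$ and last $b$ rows the persymmetric matrix $(\beta_{i+j-1})$; $r$ denotes rank. $\Gamma_{i}^{\left[\substack{a\\ b}\right]\times k}$ is the number of rank $i$ matrices $\left[\frac{A}{B}\right]$ with $A$ an $a\times k$ and $B$ a $b\times k$ persymmetric matrix over $\mathbb{F}_2$ (zero when $i$ is out of range). *)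

(* Defs.v *)
From HB Require Import structures.
From mathcomp Require Import all_boot all_order all_algebra.
From mathcomp Require Import boolp functions.

Set Implicit Arguments.
Unset Strict Implicit.
Unset Printing Implicit Defensive.

Import GRing.Theory.

Local Open Scope ring_scope.
Local Open Scope quotient_scope.

(* The unit interval of F_2((1/T)), i.e. the group of series
   \sum_(i >= 1) alpha_i T^(-i).  Indices are shifted by one: for t : unitint,
   t n is the coefficient alpha_(n+1) of T^(-(n+1)). *)
Definition unitint := nat -> 'F_2.
HB.instance Definition _ := GRing.Zmodule.on unitint.

(* P_n: the series with alpha_1 = ... = alpha_n = 0. *)
Definition unitint_sub (n : nat) : {pred unitint} :=
  [pred t : unitint | [forall i : 'I_n, t i == 0]].

Lemma unitint_subP (n : nat) (t : unitint) :
  reflect (forall i, (i < n)%N -> t i = 0) (t \in unitint_sub n).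
Proof.
apply: (iffP forallP) => [h i lt_in | h i]; last exact/eqP/h.
exact/eqP/(h (Ordinal lt_in)).
Qed.

Fact unitint_sub_zmod_closed (n : nat) : zmod_closed (unitint_sub n).
Proof.
split=> [|t u /unitint_subP ht /unitint_subP hu]; apply/unitint_subP=> // i lt_in.
have -> : (t - u) i = t i - u i by [].
by rewrite ht // hu // subr0.
Qed.
HB.instance Definition _ (n : nat) :=
  GRing.isZmodClosed.Build unitint (unitint_sub n) (unitint_sub_zmod_closed n).

Definition unitint_quot (n : nat) : Type := Quotient.quot (unitint_sub n).
HB.instance Definition _ (n : nat) := GRing.Zmodule.on (unitint_quot n).
HB.instance Definition _ (n : nat) := Quotient.on (unitint_quot n).

Lemma unitint_quotP (n : nat) (t u : unitint) :
  reflect (forall i, (i < n)%N -> t i = u i)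
          (\pi_(unitint_quot n) t == \pi_(unitint_quot n) u).
Proof.
rewrite -[X in reflect _ X]/(t == u %[mod Quotient.quot (unitint_sub n)]).
rewrite -Quotient.idealrBE.
apply: (iffP (unitint_subP _ _)) => h i lt_in.
  by apply/eqP; rewrite -subr_eq0; apply/eqP; apply: h.
by have -> : (t - u) i = t i - u i by []; rewrite h // subrr.
Qed.

(* P / P_n is finite: a class is determined by its first n coefficients. *)
Definition unitint_trunc (n : nat) (x : unitint_quot n) : {ffun 'I_n -> 'F_2} :=
  [ffun i : 'I_n => repr x i].
Definition unitint_of_trunc (n : nat) (f : {ffun 'I_n -> 'F_2}) : unitint_quot n :=
  \pi_(unitint_quot n) (fun i => oapp f 0 (insub i)).

Lemma unitint_truncK (n : nat) :
  cancel (@unitint_trunc n) (@unitint_of_trunc n).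
Proof.
move=> x; rewrite -[RHS]reprK; apply/eqP/unitint_quotP => i lt_in.
by rewrite insubT /= ffunE.
Qed.

Lemma unitint_of_truncK (n : nat) :
  cancel (@unitint_of_trunc n) (@unitint_trunc n).
Proof.
move=> f; apply/ffunP => i; rewrite ffunE.
have /eqP/unitint_quotP/(_ _ (ltn_ord i)) -> := reprK (unitint_of_trunc f).
by rewrite valK.
Qed.

HB.instance Definition _ (n : nat) : isCountable (unitint_quot n) :=
  CanIsCountable (@unitint_truncK n).
HB.instance Definition _ (n : nat) : isFinite (unitint_quot n) :=
  CanIsFinite (@unitint_truncK n).

(* With 0-based row and column indices, the entry alpha_(i+j-1) is t (i + j). *)
Definition persym (a k : nat) (t : unitint) : 'M['F_2]_(a, k) :=
  \matrix_(i < a, j < k) t (i + j)%N.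

Definition Dmx (a b k : nat) (t eta : unitint) : 'M['F_2]_(a + b, k) :=
  col_mx (persym a k t) (persym b k eta).

(* Compatibility of D with the quotients, which makes its evaluation on
   representatives in [sigma] below independent of their choice. *)
Lemma Dmx_quot (a b k n p : nat) (t t' eta eta' : unitint) :
  (a + k - 1 <= n)%N -> (b + k - 1 <= p)%N ->
  \pi_(unitint_quot n) t = \pi_(unitint_quot n) t' ->
  \pi_(unitint_quot p) eta = \pi_(unitint_quot p) eta' ->
  Dmx a b k t eta = Dmx a b k t' eta'.
Proof.
have lt c q (i : 'I_c) (j : 'I_k) : (c + k - 1 <= q)%N -> (i + j < q)%N.
  case: i j => i /= ic [j /= jk]; apply: leq_trans.
  by rewrite ltn_subRL add1n -addSn -addnS leq_add.
move=> an bp /eqP/unitint_quotP ht /eqP/unitint_quotP he.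
congr col_mx; apply/matrixP => i j; rewrite !mxE.
  by apply: ht; apply: lt an.
by apply: he; apply: lt bp.
Qed.

Definition persymmetric (a k : nat) (A : 'M['F_2]_(a, k)) : bool :=
  [forall i : 'I_a, forall j : 'I_k, forall i' : 'I_a, forall j' : 'I_k,
    (i + j == i' + j')%N ==> (A i j == A i' j')].

(* The rank i is an integer, so that Gamma and sigma vanish at negative i. *)
Definition Gamma (a b k : nat) (i : int) : nat :=
  #|[set M : 'M['F_2]_(a + b, k) |
      [&& persymmetric (usubmx M), persymmetric (dsubmx M)
        & (\rank M)%:Z == i]]|.

Definition sigma (s m k : nat) (i : int) : nat :=
  #|[set x : unitint_quot (k + s - 1) * unitint_quot (k + s + m - 1) |
      let t := repr x.1 in let eta := repr x.2 in
      [&& (\rank (Dmx (s - 1) (s - 1 + m) k t eta))%:Z == i,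
          (\rank (Dmx s (s + m - 1) k t eta))%:Z == i
        & (\rank (Dmx s (s + m) k t eta))%:Z == i]]|.

Definition Delta (s m k : nat) (i : int) : int :=
  (sigma s m k i)%:Z - 3 * (sigma s m k (i - 1))%:Z
    + 2 * (sigma s m k (i - 2))%:Z.

(* Main.v *)
Require Import Defs.
From mathcomp Require Import all_boot all_order all_algebra.
From mathcomp Require Import zify ring.

Set Implicit Arguments.
Unset Strict Implicit.
Unset Printing Implicit Defensive.

Import GRing.Theory.

Local Open Scope ring_scope.
Local Open Scope quotient_scope.

(* Let S be the row space of D^[s-1; s+m-1], and let a and b be the rows to be
   added to its two blocks.  The four ranks in the statement depend only on
   rank S and on which of a, b, a + b lie in S.  Comparing indicators pointwise,
   the identity reduces to the equality, for each value of rank S, of the number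
   of pairs with a in S, b not in S and of those with a, b not in S, a + b in S.
   The involution t |-> t + (eta shifted by m places) exchanges the two: it adds
   row i + m of the eta-block to row i of the t-block, hence it fixes S and b
   and replaces a by a + b. *)

(** * Coefficients of classes, and counting pairs of classes by their matrix *)

Lemma repr_pi_unitint (n : nat) (t : unitint) (i : nat) :
  (i < n)%N -> repr (\pi_(unitint_quot n) t) i = t i.
Proof.
move=> lt_in; have /eqP/unitint_quotP := reprK (\pi_(unitint_quot n) t).
exact.
Qed.

Lemma eq_persym (a k : nat) (t u : unitint) :
  (forall i, (i < a + k - 1)%N -> t i = u i) -> persym a k t = persym a k u.
Proof.
move=> tu; apply/matrixP=> i j; rewrite !mxE tu //.
by have := ltn_ord i; have := ltn_ord j; lia.
Qed.

Lemma persymmetric_persym (a k : nat) (t : unitint) :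
  persymmetric (persym a k t).
Proof.
apply/'forall_'forall_'forall_'forall_implyP => i j i' j' /eqP ij.
by rewrite !mxE ij.
Qed.

(** Reads the antidiagonal i + j = n at its lowest row, which keeps both indices in range, so that
    [inord] is exact, for all n <= a + k. *)
Definition antidiag (a k : nat) (A : 'M['F_2]_(a.+1, k.+1)) (n : nat) : 'F_2 :=
  A (inord (minn n a)) (inord (n - minn n a)).

Lemma persym_eqP (a k : nat) (t : unitint) (A : 'M['F_2]_(a.+1, k.+1)) :
  persymmetric A ->
  reflect (forall n, (n < (a + k).+1)%N -> t n = antidiag A n)
          (persym a.+1 k.+1 t == A).
Proof.
move=> symA; apply: (iffP eqP) => [<- n lt_n | tA].
  by rewrite /antidiag mxE !inordK; [congr t; lia | lia | lia].
apply/matrixP=> i j; have lt_i := ltn_ord i; have lt_j := ltn_ord j.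
rewrite mxE tA; last by lia.
move: symA => /'forall_'forall_'forall_'forall_implyP symA.
apply/eqP/symA; rewrite !inordK; lia.
Qed.

Lemma card_unitint_prefix (n d : nat) (c : nat -> 'F_2) : (d <= n)%N ->
  #|[set x : unitint_quot n | [forall i : 'I_d, repr x i == c i]]|
    = (2 ^ (n - d))%N.
Proof.
move=> le_dn.
(* [F] gives the values allowed at each coefficient: one for the first d, both elements of F_2 for
   the others. The set is then a product of these. *)
pose F (i : 'I_n) : {pred 'F_2} := [pred y | (i < d)%N ==> (y == c i)].
rewrite -(card_imset _ (can_inj (@unitint_truncK n))).
have -> : #|(@unitint_trunc n) @:
    [set x : unitint_quot n | [forall i : 'I_d, repr x i == c i]]|
    = #|family F|.
  apply: eq_card => f; apply/imsetP/familyP => [[x] | fF].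
    rewrite inE => /forallP xc -> i; rewrite inE ffunE; apply/implyP => lt_id.
    exact: (xc (Ordinal lt_id)).
  exists (unitint_of_trunc f); last by rewrite unitint_of_truncK.
  rewrite inE; apply/forallP => i.
  have lt_in := leq_trans (ltn_ord i) le_dn.
  have := fF (Ordinal lt_in); rewrite inE /= ltn_ord /=.
  by rewrite -{1}(unitint_of_truncK f) ffunE.
rewrite card_family foldrE big_map big_enum /=.
rewrite (bigID (fun i : 'I_n => (i < d)%N)) /=.
rewrite big1 ?mul1n => [|i lt_id].
  rewrite (eq_bigr (fun=> 2%N)) => [|i /negPf lt_id].
    rewrite prod_nat_const; congr (2 ^ _)%N.
    rewrite -sum1_card -(big_mkord (fun i => ~~ (i < d)%N) (fun=> 1%N)) /=.
    rewrite (big_cat_nat _ le_dn) //= big_nat_cond big_pred0 => [|j]; last lia.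
    rewrite add0n big_nat_cond (eq_bigl (fun j => (d <= j < n)%N)) => [|j];
      last by lia.
    by rewrite -big_nat sum_nat_const_nat muln1.
  rewrite (eq_card (B := predT)) ?card_Fp // => y.
  by rewrite !inE lt_id.
by rewrite (eq_card (B := pred1 (c i))) ?card1 // => y; rewrite !inE lt_id.
Qed.

(** With both dimensions positive there are a + k - 1 antidiagonals; each prescribes one
    coefficient, and the remaining ones are free. *)
Lemma card_persym_fiber (n a k : nat) (A : 'M['F_2]_(a, k)) :
  (0 < a)%N -> (0 < k)%N -> (a + k - 1 <= n)%N ->
  #|[set x : unitint_quot n | persym a k (repr x) == A]|
    = (persymmetric A * 2 ^ (n - (a + k - 1)))%N.
Proof.
case: a A => // a; case: k => // k A _ _ le_n.
have [symA | nsymA] := boolP (persymmetric A); last first.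
  rewrite mul0n; apply: eq_card0 => x; rewrite !inE.
  by apply: contraNF nsymA => /eqP <-; apply: persymmetric_persym.
rewrite mul1n -(card_unitint_prefix (antidiag A) le_n).
apply: eq_card => x; rewrite !inE.
have d_eq : (a.+1 + k.+1 - 1 = (a + k).+1)%N by lia.
apply/(persym_eqP _ symA)/forallP => [xA i | xA i lt_i].
  by apply/eqP/xA; rewrite -d_eq.
by apply/eqP; rewrite -d_eq in lt_i; apply: (xA (Ordinal lt_i)).
Qed.

(** All pairs of persymmetric blocks have equally many preimages under D, a power of 2. This turns
    the [Gamma] of the various block sizes into counts over one common set of pairs. *)
Lemma card_rank_Dmx (n p a b k : nat) (r : int) :
  (0 < a)%N -> (0 < b)%N -> (0 < k)%N ->
  (a + k - 1 <= n)%N -> (b + k - 1 <= p)%N ->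
  #|[set x : unitint_quot n * unitint_quot p |
      (\rank (Dmx a b k (repr x.1) (repr x.2)))%:Z == r]|
    = (2 ^ (n - (a + k - 1)) * 2 ^ (p - (b + k - 1)) * Gamma a b k r)%N.
Proof.
move=> a0 b0 k0 le_n le_p.
rewrite -sum1dep_card
  (partition_big (fun x : unitint_quot n * unitint_quot p =>
                    Dmx a b k (repr x.1) (repr x.2)) predT) //=.
rewrite /Gamma -sum1dep_card big_distrr [RHS]big_mkcond /=.
apply: eq_bigr => M _; rewrite sum1dep_card.
have [rM | rM] := eqVneq ((\rank M)%:Z) r; last first.
  rewrite !andbF; apply: eq_card0 => x; rewrite !inE.
  by apply/negbTE/andP => -[/eqP xr /eqP xM]; rewrite -xM xr eqxx in rM.
rewrite andbT muln1.
have -> : [set x : unitint_quot n * unitint_quot p |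
    ((\rank (Dmx a b k (repr x.1) (repr x.2)))%:Z == r)
      && (Dmx a b k (repr x.1) (repr x.2) == M)]
  = setX [set x : unitint_quot n | persym a k (repr x) == usubmx M]
         [set x : unitint_quot p | persym b k (repr x) == dsubmx M].
  apply/setP => x; rewrite !inE; apply/andP/andP => [[_ /eqP <-] | ].
    by rewrite col_mxKu col_mxKd.
  move=> [/eqP xu /eqP xd].
  by rewrite /Dmx xu xd vsubmxK rM.
rewrite cardsX !card_persym_fiber //.
by case: persymmetric; case: persymmetric; rewrite ?mul0n ?muln0 ?mul1n.
Qed.

(** * Ranks after adding a row to either block *)

Lemma mxrank_adds_row (F : fieldType) (p k : nat) (S : 'M[F]_(p, k))
    (v : 'rV[F]_k) :
  \rank (S + v)%MS = (\rank S + ~~ (v <= S)%MS)%N.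
Proof.
have [vS | nvS] := boolP (v <= S)%MS.
  by rewrite addn0 (addsmx_idPl vS).
apply/eqP; rewrite eqn_leq; apply/andP; split.
  by rewrite (leq_trans (mxrank_adds_leqif S v)) // leq_add2l rank_leq_row.
rewrite addn1 ltn_neqAle mxrankS ?addsmxSl // andbT.
apply: contra nvS; rewrite (mxrank_leqif_sup (addsmxSl S v)).
exact: submx_trans (addsmxSr S v).
Qed.

Lemma persymS (a k : nat) (t : unitint) :
  (persym a.+1 k t :=: persym a k t + \row_(j < k) t (a + j)%N)%MS.
Proof.
apply/eqmxP/andP; split.
  apply/row_subP => i; have [lt_ia | le_ai] := ltnP i a.
    apply: submx_trans (addsmxSl _ _); apply: eq_row_sub (Ordinal lt_ia) _.
    by apply/rowP => j; rewrite !mxE.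
  apply: submx_trans (addsmxSr _ _); apply: eq_row_sub (0 : 'I_1) _.
  by apply/rowP => j; rewrite !mxE; congr t; have := ltn_ord i; lia.
rewrite addsmx_sub; apply/andP; split.
  apply/row_subP => i; apply: eq_row_sub (widen_ord (leqnSn a) i) _.
  by apply/rowP => j; rewrite !mxE.
by apply: eq_row_sub ord_max _; apply/rowP => j; rewrite !mxE.
Qed.

(** The fractional part of T^m t. *)
Definition shift (m : nat) (t : unitint) : unitint := fun i => t (i + m)%N.

Lemma persymD (a k : nat) (t u : unitint) :
  persym a k (t + u) = persym a k t + persym a k u.
Proof. by apply/matrixP => i j; rewrite !mxE. Qed.

Lemma persym_shift_sub (a m k : nat) (t : unitint) :
  (persym a k (shift m t) <= persym (a + m) k t)%MS.
Proof.
apply/row_subP => i; have lt_im : (i + m < a + m)%N by rewrite ltn_add2r.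
apply: eq_row_sub (Ordinal lt_im) _.
by apply/rowP => j; rewrite !mxE /shift /= addnAC.
Qed.

Lemma addsmx_addl (F : fieldType) (p q k : nat) (U V : 'M[F]_(p, k))
    (W : 'M[F]_(q, k)) :
  (V <= W)%MS -> ((U + V)%R + W :=: U + W)%MS.
Proof.
move=> VW; apply/eqmxP/andP; split; rewrite addsmx_sub addsmxSr andbT.
  by rewrite addmx_sub ?addsmxSl // (submx_trans VW) ?addsmxSr.
rewrite -{1}(addrK V U) addmx_sub ?addsmxSl // eqmx_opp.
by rewrite (submx_trans VW) ?addsmxSr.
Qed.

Section Extension.

Variables (s m k : nat).
Implicit Types t u : unitint.

(** Here [s] is one less than in the theorem: [Dspace] is the space S of the overview, and [lastt],
    [lastu] are its rows a and b. *)
Definition Dspace t u : 'M['F_2]_k := (persym s k t + persym (s + m) k u)%MS.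
Definition lastt t : 'rV['F_2]_k := \row_j t (s + j)%N.
Definition lastu u : 'rV['F_2]_k := \row_j u (s + m + j)%N.

Lemma Dspace_shift t u : (Dspace (t + shift m u)%R u :=: Dspace t u)%MS.
Proof. by rewrite /Dspace persymD; apply/addsmx_addl/persym_shift_sub. Qed.

Lemma lastt_shift t u : lastt (t + shift m u) = lastt t + lastu u.
Proof. by apply/rowP => j; rewrite !mxE /shift -addnAC. Qed.

Lemma rank_D00 t u : \rank (Dmx s (s + m) k t u) = \rank (Dspace t u).
Proof. by rewrite -addsmxE. Qed.

Lemma rank_D10 t u :
  \rank (Dmx s.+1 (s + m) k t u)
    = (\rank (Dspace t u) + ~~ (lastt t <= Dspace t u)%MS)%N.
Proof.
rewrite -mxrank_adds_row -addsmxE /Dspace.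
rewrite (adds_eqmx (persymS s k t) (eqmx_refl _)).
by rewrite -!addsmxA [X in (_ + X)%MS]addsmxC.
Qed.

Lemma rank_D01 t u :
  \rank (Dmx s (s + m).+1 k t u)
    = (\rank (Dspace t u) + ~~ (lastu u <= Dspace t u)%MS)%N.
Proof.
rewrite -mxrank_adds_row -addsmxE /Dspace.
rewrite (adds_eqmx (eqmx_refl _) (persymS (s + m) k u)).
by rewrite !addsmxA.
Qed.

Lemma rank_D11 t u :
  \rank (Dmx s.+1 (s + m).+1 k t u) = \rank (Dspace t u + lastt t + lastu u)%MS.
Proof.
rewrite -addsmxE /Dspace.
rewrite (adds_eqmx (persymS s k t) (persymS (s + m) k u)).
by rewrite !addsmxA; congr (\rank (_ + _)%MS); rewrite -!addsmxA;
  congr (_ + _)%MS; rewrite addsmxC.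
Qed.

End Extension.

(** * Linear algebra over F_2 *)

Lemma F2_eq01 (x : 'F_2) : x = 0 \/ x = 1.
Proof. by case: x => [[|[|//]] ?]; [left | right]; apply: val_inj. Qed.

Lemma addrr_F2 (x : 'F_2) : x + x = 0.
Proof. by case: (F2_eq01 x) => ->; apply: val_inj. Qed.

Lemma addvv_F2 (k : nat) (v : 'rV['F_2]_k) : v + v = 0.
Proof. by apply/rowP => j; rewrite !mxE addrr_F2. Qed.

(** The only multiples of a over F_2 are 0 and a, so b lies in S + a exactly when b or b - a = a + b
    lies in S. *)
Lemma sub_adds_row_F2 (k : nat) (S : 'M['F_2]_k) (a b : 'rV['F_2]_k) :
  (b <= S + a)%MS = (b <= S)%MS || ((a + b)%R <= S)%MS.
Proof.
apply/idP/orP => [/sub_addsmxP[u ->] | [bS | abS]].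
- rewrite [u.2]mx11_scalar mul_scalar_mx; case: (F2_eq01 (u.2 0 0)) => ->.
    by left; rewrite scale0r addr0 submxMl.
  by right; rewrite scale1r addrCA addvv_F2 addr0 submxMl.
- exact: submx_trans bS (addsmxSl _ _).
rewrite -(addKr a b) addmx_sub //; first by rewrite eqmx_opp addsmxSr.
exact: submx_trans abS (addsmxSl _ _).
Qed.

Lemma card_set_sumz (T : finType) (P : pred T) :
  #|[set x | P x]|%:Z = \sum_(x : T) (P x : nat)%:Z.
Proof.
rewrite -sum1dep_card big_mkcond /= -[LHS]natz natr_sum.
by apply: eq_bigr => x _; case: (P x).
Qed.

(** * The shear involution and the pointwise identity *)

Section Shear.

Variables (s m k n p : nat).
Hypothesis hn : (s + k <= n)%N.

Let X : finType := (unitint_quot n * unitint_quot p)%type.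
Implicit Types x : X.

(** On representatives the sum is only known for the first n coefficients; by [hn] these cover every
    t-entry occurring in S and a. *)
Definition shear x : X :=
  (\pi_(unitint_quot n) (repr x.1 + shift m (repr x.2)), x.2).

Lemma shearK : involutive shear.
Proof.
move=> [x y]; rewrite /shear /=; congr pair.
rewrite -[RHS]reprK; apply/eqP/unitint_quotP => i lt_in.
have addE (u v : unitint) : (u + v) i = u i + v i by [].
by rewrite addE repr_pi_unitint // addE -addrA addrr_F2 addr0.
Qed.

Let S x := Dspace s m k (repr x.1) (repr x.2).
Let a x := lastt s k (repr x.1).
Let b x := lastu s m k (repr x.2).

Lemma Dspace_shear x : (S (shear x) :=: S x)%MS.
Proof.
apply: eqmx_trans (Dspace_shift s m k (repr x.1) (repr x.2)).
rewrite /S /Dspace /= (@eq_persym s k _ (repr x.1 + shift m (repr x.2))).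
  exact: eqmx_refl.
by move=> i lt_i; apply: repr_pi_unitint; lia.
Qed.

Lemma lastt_shear x : a (shear x) = a x + b x.
Proof.
rewrite -lastt_shift; apply/rowP => j; rewrite !mxE repr_pi_unitint //.
by have := ltn_ord j; lia.
Qed.

(** Reindexing by [shear] turns a in S into a + b in S and keeps the weight, a function of rank S.
    Once b is outside S, a + b in S already forces a outside S. *)
Lemma sum_shear (f : nat -> int) :
  \sum_(x : X) ((a x <= S x)%MS && ~~ (b x <= S x)%MS : nat)%:Z
      * f (\rank (S x))
    = \sum_(x : X) ([&& ~~ (a x <= S x), ~~ (b x <= S x)
                      & (a x + b x)%R <= S x]%MS : nat)%:Z * f (\rank (S x)).
Proof.
rewrite (reindex_inj (inv_inj shearK)) /=; apply: eq_bigr => x _.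
rewrite Dspace_shear lastt_shear -/(b x) !Dspace_shear.
congr ((nat_of_bool _)%:Z * _).
have [bS | nbS] := boolP (b x <= S x)%MS; first by rewrite !andbF.
have [abS | nabS] := boolP ((a x + b x)%R <= S x)%MS; last by rewrite !andbF.
rewrite /= andbT; apply/esym; apply: contra nbS => aS.
by rewrite -(addKr (a x) (b x)) addmx_sub // eqmx_opp.
Qed.

End Shear.

(** The [sg] terms survive only when a and b both lie in S. The two terms in [f] repair the two
    configurations where the identity fails pointwise; they have opposite signs and cancel after
    summation by [sum_shear]. *)
Lemma rank_indicators (k : nat) (S : 'M['F_2]_k) (a b : 'rV['F_2]_k) (i : int) :
  let A := (a <= S)%MS in let B := (b <= S)%MS in
  let r00 := (\rank S)%:Z in
  let r10 := (\rank S + ~~ A)%N%:Z in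
  let r01 := (\rank S + ~~ B)%N%:Z in
  let r11 := (\rank (S + a + b)%MS)%:Z in
  let sg j := ([&& r00 == j, r10 == j & r11 == j] : nat)%:Z in
  let f j := (j%:Z == i - 1 : nat)%:Z - (j%:Z == i - 2 : nat)%:Z in
  (r11 == i : nat)%:Z
    = (r01 == i - 1 : nat)%:Z + 2 * (r10 == i - 1 : nat)%:Z
      - 2 * (r00 == i - 2 : nat)%:Z
      + (sg i - 3 * sg (i - 1) + 2 * sg (i - 2))
      + ([&& ~~ A, ~~ B & (a + b)%R <= S]%MS : nat)%:Z * f (\rank S)
      - (A && ~~ B : nat)%:Z * f (\rank S).
Proof.
rewrite /= !mxrank_adds_row sub_adds_row_F2.
(* This discards the inconsistent cases with a in S; in each other case the identity is arithmetic
   in rank S. *)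
have abA : (a <= S)%MS -> ((a + b)%R <= S)%MS = (b <= S)%MS.
  move=> aS; apply/idP/idP => [abS | bS]; last exact: addmx_sub.
  by rewrite -(addKr a b) addmx_sub // eqmx_opp.
case: (a <= S)%MS abA => [->// | _]; case: (b <= S)%MS;
  case: ((a + b)%R <= S)%MS => /=; lia.
Qed.

Unset Implicit Arguments.

(* For m = 0 the second block of the third term, s + (m - 1) rows, has s - 1
   rows; hence the truncated subtraction is taken as (s + m) - 1. *)
Theorem theorem2p2 (s m k i : nat) (hs : (2 <= s)%N) (hk : (1 <= k)%N)
    (hi : (i <= minn (2 * s + m) k)%N) :
  (Gamma s (s + m) k i%:Z)%:Z =
    2 * (Gamma (s - 1) (s - 1 + (m + 1)) k (i%:Z - 1))%:Z
    + 4 * (Gamma s (s + m - 1) k (i%:Z - 1))%:Z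
    - 8 * (Gamma (s - 1) (s - 1 + m) k (i%:Z - 2))%:Z
    + Delta s m k i%:Z.
Proof.
case: s hs {hi} => [//|s] s_gt0.
pose X : finType :=
  (unitint_quot (k + s.+1 - 1) * unitint_quot (k + s.+1 + m - 1))%type.
(* All counts are taken over the pairs of classes used by [sigma]. Each row removed from a block
   frees one coefficient and so contributes a factor 2. *)
pose R c d (r : int) : int :=
  \sum_(x : X) ((\rank (Dmx c d k (repr x.1) (repr x.2)))%:Z == r : nat)%:Z.
have RE c d r : (0 < c <= s.+1)%N -> (0 < d <= s.+1 + m)%N ->
    R c d r = (2 ^ (s.+1 - c) * 2 ^ (s.+1 + m - d) * Gamma c d k r)%N%:Z.
  move=> c_bd d_bd; rewrite /R -card_set_sumz card_rank_Dmx; try lia.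
  by congr (2 ^ _ * 2 ^ _ * _)%N%:Z; lia.
have s1E : (s.+1 - 1 = s)%N by lia.
have smE : (s.+1 + m - 1 = s + m)%N by lia.
rewrite s1E smE (_ : s + (m + 1) = (s + m).+1)%N; last lia.
have G11 : R s.+1 (s + m).+1 i%:Z = (Gamma s.+1 (s.+1 + m) k i%:Z)%:Z.
  by rewrite RE ?addSn ?subnn ?mul1n //; lia.
have G01 : R s (s + m).+1 (i%:Z - 1) = 2 * (Gamma s (s + m).+1 k (i%:Z - 1))%:Z.
  by rewrite RE ?addSn ?subnn ?subSnn ?muln1 //; lia.
have G10 : R s.+1 (s + m)%N (i%:Z - 1)
    = 2 * (Gamma s.+1 (s + m) k (i%:Z - 1))%:Z.
  by rewrite RE ?addSn ?subnn ?subSnn ?mul1n //; lia.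
have G00 : R s (s + m)%N (i%:Z - 2) = 4 * (Gamma s (s + m) k (i%:Z - 2))%:Z.
  by rewrite RE ?addSn ?subnn ?subSnn //; lia.
rewrite -G11 -G01.
(* One factor 2 of the coefficient 4, and a factor 4 of the coefficient 8, are absorbed by the free
   coefficients. *)
rewrite (_ : 4 * _ = 2 * R s.+1 (s + m)%N (i%:Z - 1)); last by rewrite G10; lia.
rewrite (_ : 8 * _ = 2 * R s (s + m)%N (i%:Z - 2)); last by rewrite G00; lia.
have sigmaE j : (sigma s.+1 m k j)%:Z = \sum_(x : X)
    ([&& (\rank (Dmx s (s + m) k (repr x.1) (repr x.2)))%:Z == j,
         (\rank (Dmx s.+1 (s + m) k (repr x.1) (repr x.2)))%:Z == j
       & (\rank (Dmx s.+1 (s + m).+1 k (repr x.1) (repr x.2)))%:Z == j]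
      : nat)%:Z.
  rewrite /sigma card_set_sumz; apply: eq_bigr => x _.
  by rewrite s1E smE.
rewrite /Delta !sigmaE /R.
have hn : (s + k <= k + s.+1 - 1)%N by lia.
have := @sum_shear s m k _ (k + s.+1 + m - 1) hn
  (fun j => (j%:Z == i%:Z - 1 : nat)%:Z - (j%:Z == i%:Z - 2 : nat)%:Z).
move/eqP; rewrite -subr_eq0 -sumrB => /eqP shear0.
(* Subtracting the vanishing sum supplies the [f] terms of [rank_indicators], so both sides now
   agree term by term. *)
rewrite -[RHS]subr0 -[X in _ = _ - X]shear0 !mulr_sumr -!sumrN -!big_split /=.
apply: eq_bigr => x _.
rewrite rank_D11 rank_D10 rank_D01 rank_D00 rank_indicators.
ring.
Qed.
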